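(* Let $(G,\tau,\oplus)$ be a topological gyrogroup, let $H$ be a locally compact strongly $L$-subgyrogroup of $G$, and let $\pi:G\to G/H$ be the natural quotient mapping of $G$ onto the quotient space $G/H$. Then there exists an open neighborhood $U$ of the identity element $0$ in $G$ such that $\pi(\overline{U})$ is closed in $G/H$ and the restriction of $\pi$ to $\overline{U}$ is a perfect mapping from $\overline{U}$ onto the subspace $\pi(\overline{U})$ of $G/H$.
   Context: A gyrogroup is a nonempty set $G$ with a binary operation $\oplus$ such that: (G1) there is an identity $0\in G$ with $0\oplus x=x=x\oplus 0$ for all $x\in G$; (G2) each $x\in G$ has an inverse $\ominus x$ with $\ominus x\oplus x=0=x\oplus(\ominus x)$; (G3) for all $x,y\in G$ there is an automorphism $\text{gyr}[x,y]$ of $(G,\oplus)$ with $x\oplus(y\oplus z)=(x\oplus y)\oplus\text{gyr}[x,y](z)$ for all $z\in G$; (G4) $\text{gyr}[x\oplus y,y]=\text{gyr}[x,y]$ for all $x,y\in G$. A topological gyrogroup $(G,\tau,\oplus)$ is a gyrogroup $(G,\oplus)$ with a topology $\tau$ such that $\oplus:G\times G\to G$ is (jointly) continuous and $x\mapsto\ominus x$ is continuous. Standing assumption: topological gyrogroups are Hausdorff. A nonempty subset $H\subseteq G$ is a subgyrogroup if $\oplus$ restricts to a binary operation on $H$, for all $x,y\in H$ the restriction of $\text{gyr}[x,y]$ to $H$ is a bijective homomorphism $H\to\text{gyr}[x,y](H)$, and $(H,\oplus|_{H\times H})$ is a gyrogroup. A subgyrogroup $H$ is a strongly $L$-subgyrogroup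 if $\text{gyr}[a,b](H)\subseteq H$ for all $a,b\in G$. $H$ is locally compact if it is so in the subspace topology. For a strongly $L$-subgyrogroup $H$, the cosets $a\oplus H=\{a\oplus h:h\in H\}$ partition $G$; $G/H$ is the set of these cosets, $\pi(a)=a\oplus H$, and $G/H$ has the quotient topology ($O\subseteq G/H$ is open iff $\pi^{-1}(O)$ is open in $G$). $\overline{U}$ is the closure of $U$ in $G$. A perfect mapping is a continuous closed mapping with compact fibers. *)

(* Defs.v *)
From HB Require Import structures.
From mathcomp Require Import all_boot.
From mathcomp Require Import boolp classical_sets functions topology.

Set Implicit Arguments.
Unset Strict Implicit.
Unset Printing Implicit Defensive.

Local Open Scope classical_set_scope.

Definition is_automorphism (T : Type) (op : T -> T -> T) (f : T -> T) : Prop :=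
  bijective f /\ {morph f : x y / op x y}.

Record gyrogroup_axioms (T : Type) (op : T -> T -> T) (e : T) (inv : T -> T)
    (gy : T -> T -> T -> T) : Prop := GyrogroupAxioms {
  gyro_idl : forall x, op e x = x ;
  gyro_idr : forall x, op x e = x ;
  gyro_invl : forall x, op (inv x) x = e ;
  gyro_invr : forall x, op x (inv x) = e ;
  gyro_aut : forall x y, is_automorphism op (gy x y) ;
  gyro_assoc : forall x y z, op x (op y z) = op (op x y) (gy x y z) ;
  gyro_loop : forall x y, gy (op x y) y = gy x y
}.

Definition is_gyrogroup (T : Type) (op : T -> T -> T) : Prop :=
  exists e inv gy, gyrogroup_axioms op e inv gy.

(* The identity, the inverses and the gyrations are determined by the
   operation, so bundling them adds no structure. *)
HB.mixin Record isGyrogroup (G : Type) := {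
  gadd : G -> G -> G ;
  gzero : G ;
  gopp : G -> G ;
  gyr : G -> G -> G -> G ;
  gyrogroupP : gyrogroup_axioms gadd gzero gopp gyr
}.

#[short(type="gyrogroupType")]
HB.structure Definition Gyrogroup := {G of isGyrogroup G}.

Declare Scope gyro_scope.
Delimit Scope gyro_scope with gyro.
Notation "x ⊕ y" := (gadd x y) (at level 50, left associativity) : gyro_scope.
Notation "⊖ x" := (gopp x) (at level 35, right associativity) : gyro_scope.
Notation "0" := (@gzero _) : gyro_scope.
Local Open Scope gyro_scope.

HB.mixin Record Gyrogroup_isTopological G & Topological G & Gyrogroup G := {
  gadd_continuous : continuous (fun p : G * G => p.1 ⊕ p.2) ;
  gopp_continuous : continuous (fun x : G => ⊖ x) ;
  gyro_hausdorff : hausdorff_space G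
}.

#[short(type="topologicalGyrogroupType")]
HB.structure Definition TopologicalGyrogroup :=
  {G of Topological G & Gyrogroup G & Gyrogroup_isTopological G}.

Section Subgyrogroups.
Context {G : gyrogroupType}.
Implicit Types H : set G.

Definition gadd_closed H : Prop := forall x y, H x -> H y -> H (x ⊕ y).

Definition restr_gadd H (cH : gadd_closed H) (x y : H) : H :=
  SigSub (mem_set (cH _ _ (set_valP x) (set_valP y))).

Record subgyrogroup H : Prop := Subgyrogroup {
  subgyro_nonempty : H !=set0 ;
  subgyro_closed : gadd_closed H ;
  subgyro_gyr_bij : forall x y, H x -> H y ->
    set_bij H (gyr x y @` H) (gyr x y) ;
  subgyro_gyr_morph : forall x y, H x -> H y ->
    forall a b, H a -> H b -> gyr x y (a ⊕ b) = gyr x y a ⊕ gyr x y b ;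
  subgyro_gyrogroup : is_gyrogroup (restr_gadd subgyro_closed)
}.

Definition strongly_L_subgyrogroup H : Prop :=
  subgyrogroup H /\ forall a b, gyr a b @` H `<=` H.

Definition lcoset (a : G) H : set G := [set a ⊕ h | h in H].

Definition coset_space H : Type := {C : set G | exists a, C = lcoset a H}.

Definition coset_proj H (a : G) : coset_space H :=
  exist _ (lcoset a H) (ex_intro _ a erefl).

HB.instance Definition _ H := gen_eqMixin (coset_space H).
HB.instance Definition _ H := gen_choiceMixin (coset_space H).

End Subgyrogroups.

Section QuotientTopology.
Context {G : topologicalGyrogroupType} (H : set G).

Definition coset_open (O : set (coset_space H)) : Prop :=
  open (coset_proj H @^-1` O).

Let coset_openT : coset_open setT.
Proof. exact: openT. Qed.

Let coset_openI (A B : set (coset_space H)) :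
  coset_open A -> coset_open B -> coset_open (A `&` B).
Proof. exact: openI. Qed.

Let coset_open_bigU (I : Type) (f : I -> set (coset_space H)) :
  (forall i, coset_open (f i)) -> coset_open (\bigcup_i f i).
Proof. by move=> fo; apply: bigcup_open => i _; exact: fo. Qed.

HB.instance Definition _ := isOpenTopological.Build (coset_space H)
  coset_openT coset_openI coset_open_bigU.

End QuotientTopology.

(* Stated on the subspace A itself: `locally_compact A` only asks that the
   trace on A of a neighborhood lie in a compact set of T, not of A. *)
Definition locally_compact_subset {T : topologicalType} (A : set T) : Prop :=
  locally_compact [set: set_type A].

Definition perfect_mapping {X Y : topologicalType} (f : X -> Y) : Prop :=
  [/\ continuous f,
      (forall C : set X, closed C -> closed (f @` C)) &
      (forall y : Y, compact (f @^-1` [set y]))].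

(* The restriction of f to A, as a map between the subspaces A and f @` A. *)
Definition restrict_onto_image {X Y : Type} (f : X -> Y) (A : set X) :
    A -> f @` A :=
  fun x => SigSub (image_f f (valP x)).

Arguments restrict_onto_image {X Y} f A x.

(* Main.v *)
(* A gyrogroup is a left Bol loop, so right translations are homeomorphisms and
   pi is open. Choose U so small that a in cl U and c in cl U with a^-1 c in H
   forces a^-1 c into a compact set K of H, with some room to spare. If a filter
   F on cl U has pi F -> pi y, then y may be moved inside its coset into a small
   neighborhood of cl U; afterwards every member of F meets O + K for all
   neighborhoods O of y, so compactness of K makes F cluster at a point of
   cl U in the coset of y. Closedness of the image, closedness of pi on cl U and
   compactness of the fibers are all instances of this clustering property. *)
Require Import Defs.
From HB Require Import structures.
From mathcomp Require Import all_boot.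
From mathcomp Require Import boolp classical_sets functions topology.

Local Open Scope classical_set_scope.
Local Open Scope gyro_scope.

(** * Algebra of gyrogroups *)

Section GyrogroupTheory.
Context {G : gyrogroupType}.
Implicit Types a b c x y z : G.

Lemma gadd0l x : 0 ⊕ x = x.
Proof. exact: (gyro_idl (@gyrogroupP G)). Qed.

Lemma gadd0r x : x ⊕ 0 = x.
Proof. exact: (gyro_idr (@gyrogroupP G)). Qed.

Lemma gaddNl x : ⊖ x ⊕ x = 0.
Proof. exact: (gyro_invl (@gyrogroupP G)). Qed.

Lemma gaddNr x : x ⊕ ⊖ x = 0.
Proof. exact: (gyro_invr (@gyrogroupP G)). Qed.

Lemma gyroassoc x y z : x ⊕ (y ⊕ z) = (x ⊕ y) ⊕ gyr x y z.
Proof. exact: (gyro_assoc (@gyrogroupP G)). Qed.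

Lemma left_loop x y : gyr (x ⊕ y) y = gyr x y.
Proof. exact: (gyro_loop (@gyrogroupP G)). Qed.

Lemma gyr_bij x y : bijective (gyr x y).
Proof. by have [] := gyro_aut (@gyrogroupP G) x y. Qed.

Lemma gadd_injr a : injective (gadd a).
Proof.
move=> b c /(congr1 (gadd (⊖ a))); rewrite !gyroassoc gaddNl !gadd0l.
exact/bij_inj/gyr_bij.
Qed.

Lemma gyr0 a z : gyr 0 a z = z.
Proof.
by apply: (@gadd_injr a); rewrite -{1}(gadd0l a) -gyroassoc !gadd0l.
Qed.

(** The loop property turns [gyr (⊖ a) a] into [gyr 0 a], which is the identity. *)
Lemma gaddKl a b : ⊖ a ⊕ (a ⊕ b) = b.
Proof. by rewrite gyroassoc -left_loop gaddNl gyr0 gadd0l. Qed.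

Lemma goppK a : ⊖ ⊖ a = a.
Proof. by rewrite -[LHS]gadd0r -(gaddNl a) gaddKl. Qed.

Lemma gaddNKl a b : a ⊕ (⊖ a ⊕ b) = b.
Proof. by rewrite -{1}(goppK a) gaddKl. Qed.

Lemma gyr_inv a b z : gyr (⊖ a) (a ⊕ b) (gyr a b z) = z.
Proof.
apply: (@gadd_injr b).
by rewrite -{1}(gaddKl a b) -gyroassoc -gyroassoc gaddKl.
Qed.

Lemma gyr_inv_loop x y z : gyr x (y ⊕ x) (gyr y x z) = z.
Proof. by rewrite -{1}(gaddKl y x) left_loop gyr_inv. Qed.

Lemma left_Bol x y z : x ⊕ (y ⊕ (x ⊕ z)) = (x ⊕ (y ⊕ x)) ⊕ z.
Proof. by rewrite (gyroassoc y) gyroassoc gyr_inv_loop. Qed.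

(** Right division, in the form that the left Bol identity suggests. No gyration occurs in it, so
    continuity in [c] comes from that of [⊕] alone. *)
Definition grdiv c b := ⊖ b ⊕ ((b ⊕ c) ⊕ ⊖ b).

Lemma grdivK c b : grdiv c b ⊕ b = c.
Proof.
by rewrite /grdiv -left_Bol gaddNl gadd0r gaddKl.
Qed.

Lemma gaddK a b : grdiv (a ⊕ b) b = a.
Proof.
(* By the loop property [c] is a function of [c ⊕ b], so right translations are injective. *)
have K c : (c ⊕ b) ⊕ gyr (c ⊕ b) b (⊖ b) = c.
  by rewrite left_loop -gyroassoc gaddNr gadd0r.
by rewrite -[LHS]K grdivK K.
Qed.

Lemma grdivv a : grdiv a a = 0.
Proof. by rewrite -[in X in grdiv X](gadd0l a) gaddK. Qed.

(** * Strongly L-subgyrogroups and their cosets *)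

Section StronglyL.
Context {H : set G} (sLH : strongly_L_subgyrogroup H).

Lemma strongly_L_closed : gadd_closed H.
Proof. by case: sLH => [[]]. Qed.

Lemma strongly_L_gyr a b z : H z -> H (gyr a b z).
Proof. by move=> Hz; apply: sLH.2; exists z. Qed.

(** The inverse of a gyration is again a gyration by [gyr_inv], so it preserves [H] too. *)
Lemma strongly_L_gyr_surj a b z : H z -> exists2 w, H w & gyr a b w = z.
Proof.
case: (gyr_bij a b) => g _ gK Hz; exists (g z); last exact: gK.
by rewrite -[g z](gyr_inv a b) gK; exact: strongly_L_gyr.
Qed.

(** The identity of [H] is idempotent in [G], and left cancellation leaves [0] as the only
    idempotent. *)
Lemma strongly_L0 : H 0.
Proof.
case: sLH => -[_ cH _ _ [e [inv [gy ax]]]] _.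
have ee := congr1 set_val (gyro_idl ax e).
suff <- : set_val e = 0 by exact: set_valP.
by apply: (@gadd_injr (set_val e)); rewrite gadd0r; exact: ee.
Qed.

Lemma strongly_L_opp x : H x -> H (⊖ x).
Proof.
move=> Hx; case: (sLH) => -[_ cH _ _ [e [inv [gy ax]]]] _.
have ee := congr1 set_val (gyro_idl ax e).
have e0 : set_val e = 0.
  by apply: (@gadd_injr (set_val e)); rewrite gadd0r; exact: ee.
pose x' : H := SigSub (mem_set Hx).
have xx' := congr1 set_val (gyro_invr ax x').
suff -> : ⊖ x = set_val (inv x') by exact: set_valP.
by apply: (@gadd_injr x); rewrite gaddNr -e0; exact: esym.
Qed.

Lemma coset_projP x y :
  coset_proj H x = coset_proj H y <-> exists2 h, H h & x = y ⊕ h.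
Proof.
split=> [/(congr1 sval)/= xy|[h Hh ->]].
  have : lcoset x H x by exists 0; [exact: strongly_L0|exact: gadd0r].
  by rewrite xy => -[h Hh <-]; exists h.
apply: eq_exist; apply/seteqP; split=> _ [k Hk <-].
  (* Regrouping [(y ⊕ h) ⊕ k] needs a preimage of [k] under [gyr y h] inside [H]; the other
     inclusion needs only invariance. *)
  have [w Hw <-] := strongly_L_gyr_surj y h k Hk.
  by exists (h ⊕ w); [exact: strongly_L_closed|exact: gyroassoc].
exists (gyr y h (⊖ h ⊕ k)); last by rewrite -gyroassoc gaddNKl.
by apply/strongly_L_gyr/strongly_L_closed => //; exact: strongly_L_opp.
Qed.

End StronglyL.

End GyrogroupTheory.

(** * Perfect restrictions from clustering of filters *)

Section SubspaceTopology.
Context {X Y : topologicalType}.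
Implicit Types A B : set X.

Lemma compact_preimage_val A B :
  B `<=` A -> compact B -> compact (set_val @^-1` B : set A).
Proof.
move=> BA cB F FF FB; have [x [Bx clx]] := cB (set_val @ F) _ FB.
exists (SigSub (mem_set (BA _ Bx))); split=> // S N FS.
rewrite nbhsE => -[_ [[M oM <-] Mx] MN].
have FS' : (set_val @ F) (set_val @` S).
  by apply: (@filterS _ F _ S) => // t St; exists t.
have [|_ [[t St <-] Mt]] := clx _ M FS'; first exact: open_nbhs_nbhs.
by exists t; split=> //; exact: MN.
Qed.

Context (f : X -> Y) (A : set X).
Hypotheses (f_cont : continuous f) (A_closed : closed A).
Hypothesis f_proper : forall (F : set_system X) (y : Y), ProperFilter F ->
  F A -> f @ F --> y -> exists2 x, A x /\ f x = y & cluster F x.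

Lemma closed_image_proper (C : set X) :
  C `<=` A -> closed C -> closed (f @` C).
Proof.
move=> CA clC z cz.
(* The traces on [C] of preimages of neighborhoods of [z] are nonempty because [z] is in the closure
   of the image. *)
pose F := filter_from (nbhs z) (fun O => C `&` f @^-1` O).
have FF : ProperFilter F.
  apply: filter_from_proper => [|O /cz[_ [[x Cx <-] Ox]]]; last by exists x.
  apply: filter_from_filter => [|O O' zO zO'].
    by exists setT; exact: filterT.
  by exists (O `&` O'); [exact: filterI|move=> x [Cx [Ox O'x]]].
have FC : F C by exists setT; [exact: filterT|move=> x []].
have [||x [_ <-] clx] := f_proper F z FF; first by apply: filterS FC.
  by move=> O zO; exists O => // x [].
by exists x => //; apply: clC => N xN; exact: clx.
Qed.

Lemma compact_fiber_proper (y : Y) : compact (A `&` f @^-1` [set y]).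
Proof.
move=> F FF FAy; have [||x [Ax fx] clx] := f_proper F y FF.
- by apply: filterS FAy => x [].
- move=> O yO; apply: (@filterS _ F _ _ _ _ FAy) => x [_ /= ->].
  exact: nbhs_singleton.
- by exists x.
Qed.

Lemma perfect_restrict_proper : perfect_mapping (restrict_onto_image f A).
Proof.
split.
- apply/continuousP => _ [Q oQ <-]; exists (f @^-1` Q) => //.
  by move/continuousP : f_cont; exact.
- move=> D /closed_openC[O oO DO].
  have -> : restrict_onto_image f A @` D = set_val @^-1` (f @` (A `&` ~` O)).
    apply/seteqP; split=> [_ [t Dt <-]|[y p] [x [Ax nOx] /= fx]].
      exists (set_val t) => //; split; first exact: set_valP.
      by move=> Ot; have : (~` D) t by rewrite -DO.
    exists (SigSub (mem_set Ax)).
      apply: contrapT => nD; apply: nOx; move: nD.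
      by rewrite -[~ D _]/((~` D) _) -DO.
    exact: val_inj.
  move/continuous_closedP : (@initial_continuous (f @` A) Y set_val); apply.
  apply: closed_image_proper; first by move=> x [].
  exact: closedI A_closed (open_closedC oO).
- move=> y; rewrite (_ : _ @^-1` _ =
      set_val @^-1` (A `&` f @^-1` [set set_val y])).
    by apply: compact_preimage_val (compact_fiber_proper _) => x [].
  apply/seteqP; split=> t /=; first by move=> <-; split=> //; exact: set_valP.
  by move=> [_ fty]; exact: val_inj.
Qed.

End SubspaceTopology.

(** * The coset projection and clustering along cosets *)

Section Topology.
Context {G : topologicalGyrogroupType}.
Implicit Types a b x y : G.

Lemma gadd_cvg (T : Type) (F : set_system T) (f g : T -> G) a b :
  Filter F -> f x @[x --> F] --> a -> g x @[x --> F] --> b ->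
  f x ⊕ g x @[x --> F] --> a ⊕ b.
Proof.
move=> FF fa gb; apply: continuous2_cvg fa gb.
exact: (@gadd_continuous G (a, b)).
Qed.

Lemma grdiv_continuousl b : continuous (fun c : G => grdiv c b).
Proof.
move=> c; apply: gadd_cvg; first exact: cvg_cst.
apply: gadd_cvg; last exact: cvg_cst.
by apply: gadd_cvg; [exact: cvg_cst|exact: cvg_id].
Qed.

Lemma nbhs_gadd a b (N : set G) : nbhs (a ⊕ b) N ->
  exists A B, [/\ nbhs a A, nbhs b B & forall x y, A x -> B y -> N (x ⊕ y)].
Proof.
move=> /(@gadd_continuous G (a, b))[[A B] [aA bB] AB].
by exists A, B; split=> // x y Ax By; exact: (AB (x, y)).
Qed.

Lemma nbhs_gsub a b (N : set G) : nbhs (⊖ a ⊕ b) N ->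
  exists A B, [/\ nbhs a A, nbhs b B & forall x y, A x -> B y -> N (⊖ x ⊕ y)].
Proof.
move=> /nbhs_gadd[A [B [/gopp_continuous aA bB AB]]].
by exists ((fun x => ⊖ x) @^-1` A), B; split=> // x y; exact: AB.
Qed.

Lemma compact_cluster_gadd (K : set G) y (F : set_system G) :
  compact K -> ProperFilter F ->
  (forall O, nbhs y O -> F [set o ⊕ k | o in O & k in K]) ->
  exists2 k, K k & cluster F (y ⊕ k).
Proof.
move=> cK FF FOK.
(* A basic set of [E] consists of the [k] in [K] for which [O ⊕ k] meets [A]. If [E] clusters at
   [k], continuity of [⊕] makes [F] cluster at [y ⊕ k]. *)
pose E := filter_from [set OA : set G * set G | nbhs y OA.1 /\ F OA.2]
  (fun OA => [set k | K k /\ exists2 o, OA.1 o & OA.2 (o ⊕ k)]).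
have EE : ProperFilter E.
  apply: filter_from_proper => [|[O A] /= [yO FA]].
    apply: filter_from_filter => [|[O A] [O' A'] /= [yO FA] [yO' FA']].
      by exists (setT, setT); split; exact: filterT.
    exists (O `&` O', A `&` A'); first by split; exact: filterI.
    by move=> k /= [Kk [o [Oo O'o] [Aok A'ok]]]; split; split=> //; exists o.
  have [_ [[o Oo [k Kk <-]] Aok]] := filter_ex (filterI (FOK _ yO) FA).
  by exists k; split=> //; exists o.
have EK : E K by exists (setT, setT) => [|k []] //; split; exact: filterT.
have [k [Kk clk]] := cK E EE EK; exists k => // A N FA.
move=> /nbhs_gadd[O [M [yO kM OMN]]].
have EOA : E [set k | K k /\ exists2 o, O o & A (o ⊕ k)] by exists (O, A).
have [k' [[Kk' [o Oo Aok']] Mk']] := clk _ _ EOA kM.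
by exists (o ⊕ k'); split=> //; exact: OMN.
Qed.

Context {H : set G} (sLH : strongly_L_subgyrogroup H).

Lemma coset_proj_continuous : continuous (coset_proj H).
Proof. by apply/continuousP. Qed.

(** The saturation of [O] is the union of its right translates by elements of [H], each the preimage
    of [O] under a right division. *)
Lemma coset_proj_open (O : set G) : open O -> open (coset_proj H @` O).
Proof.
move=> oO; suff -> : open (coset_proj H @` O) =
    open (\bigcup_(h in H) ((fun c => grdiv c h) @^-1` O)).
  apply: bigcup_open => h _.
  by move/continuousP : (grdiv_continuousl h); exact.
rewrite [LHS]/open/= /coset_open; congr open; apply/seteqP; split=> x.
  move=> [o Oo /esym/(coset_projP sLH)[h Hh ->]].
  by exists h => //=; rewrite gaddK.
move=> [h Hh /= Oxh]; exists (grdiv x h) => //.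
by apply/esym/(coset_projP sLH); exists h; rewrite ?grdivK.
Qed.

Lemma cluster_coset (C K N V : set G) (F : set_system G) y :
  closed C -> compact K -> K `<=` H -> nbhs 0 V ->
  (forall v c, V v -> C c -> nbhs (⊖ v ⊕ c) N) ->
  (forall a c, N a -> C c -> H (⊖ a ⊕ c) -> K (⊖ a ⊕ c)) ->
  ProperFilter F -> F C -> coset_proj H @ F --> coset_proj H y ->
  exists2 x, C x /\ coset_proj H x = coset_proj H y & cluster F x.
Proof.
move=> clC cK KH V0 VCN NCK FF FC Fy.
(* As the projection is open, the image of [O] is a neighborhood of the limit, and its preimage is
   [O ⊕ H]. *)
have FOH z O : coset_proj H z = coset_proj H y -> nbhs z O ->
    F [set o ⊕ h | o in O & h in H].
  move=> zy; rewrite nbhsE => -[Q [oQ Qz] QO].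
  have : nbhs (coset_proj H y) (coset_proj H @` Q).
    by apply: open_nbhs_nbhs; split; [exact: coset_proj_open|exists z].
  move=> /Fy; apply: (@filterS _ F) => x [o Qo /esym].
  move=> /(coset_projP sLH)[h Hh ->].
  by exists o; [exact: QO|exists h].
(* Moving y inside its coset: if o is close to y and c = o + h is in C, then
   o = v + y with v close to 0, and -v + c = y + w for some w in H. *)
have [z zy zN] : exists2 z, coset_proj H z = coset_proj H y & nbhs z N.
  have yV : nbhs y [set o | V (grdiv o y)].
    by apply: grdiv_continuousl; rewrite grdivv.
  have [_ [[o Vo [h Hh <-]] Coh]] := filter_ex (filterI (FOH _ _ erefl yV) FC).
  have [w Hw wh] := strongly_L_gyr_surj sLH (grdiv o y) y h Hh.
  exists (y ⊕ w); first by apply/(coset_projP sLH); exists w.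
  have <- : ⊖ grdiv o y ⊕ (o ⊕ h) = y ⊕ w.
    by rewrite -wh -{2}(grdivK o y) -gyroassoc gaddKl.
  exact: VCN.
(* With [o] restricted to [N], a point [o ⊕ h] of [C] forces [h] into [K]. *)
have [|k Kk clk] := compact_cluster_gadd K z F cK FF.
  move=> O zO; have zON : nbhs z (O `&` N) by exact: filterI.
  apply: filterS2 (FOH _ _ zy zON) FC => _ [o [Oo No] [h Hh <-]] Coh.
  exists o => //; exists h => //.
  by rewrite -(gaddKl o h); apply: NCK; rewrite ?gaddKl.
exists (z ⊕ k) => //; split.
  by apply: clC => A; exact: clk.
by rewrite -zy; apply/(coset_projP sLH); exists k => //; exact: KH.
Qed.

End Topology.

(** Carries local compactness from the subtype to the ambient space, where [⊕] can be applied to [W]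
    and [K]. *)
Lemma locally_compact_nbhs {T : topologicalType} (A : set T) x :
  locally_compact_subset A -> A x ->
  exists W K, [/\ nbhs x W, compact K, K `<=` A & W `&` A `<=` K].
Proof.
move=> lcA Ax; have [K xK [cK _]] := lcA (SigSub (mem_set Ax)) I.
have : nbhs (SigSub (mem_set Ax) : A) K.
  by apply: (@filterS _ (nbhs _) _ _ _ _ xK) => t; exact.
rewrite nbhsE => -[_ [[W oW <-] Wx] WK].
exists W, (set_val @` K); split.
- by exists W.
- apply: continuous_compact cK.
  by apply: continuous_subspaceT; exact: initial_continuous.
- by move=> _ [t _ <-]; exact: set_valP.
- by move=> t [Wt At]; exists (SigSub (mem_set At)) => //; exact: WK.
Qed.

Theorem theorem4p2 (G : topologicalGyrogroupType) (H : set G)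
  (H_strongL : strongly_L_subgyrogroup H)
  (H_lcompact : locally_compact_subset H) :
  exists U : set G,
    [/\ open_nbhs (0 : G) U,
        closed (coset_proj H @` closure U),
        perfect_mapping (restrict_onto_image (coset_proj H) (closure U)) &
        range (restrict_onto_image (coset_proj H) (closure U)) = setT].
Proof.
have [W [K [W0 cK KH WHK]]] :=
  locally_compact_nbhs H 0 H_lcompact (strongly_L0 H_strongL).
have gsub00 (N : set G) : nbhs 0 N -> exists2 A, open_nbhs (0 : G) A &
    forall x y, A x -> A y -> N (⊖ x ⊕ y).
  rewrite -[in nbhs _ _](gaddNl 0) => /nbhs_gsub[A [B [A0 B0 AB]]].
  exists (interior (A `&` B)).
    by split; [exact: open_interior|exact: filterI].
  by move=> x y /interior_subset[Ax _] /interior_subset[_ By]; exact: AB.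
(* Three successive shrinkings: [U] puts its closure inside [V], [V] gives the room to move [y] into
   [N], and [N] keeps differences in [W]. *)
have [N [oN N0] NW] := gsub00 W W0.
have [V V0 VN] := gsub00 N (open_nbhs_nbhs (conj oN N0)).
have [U [oU U0] UV] := gsub00 V (open_nbhs_nbhs V0).
(* Some right translate [u ⊕ x] with [u] in [U] lies in [U], and [x] is [⊖ u ⊕ (u ⊕ x)]. *)
have clUV x : closure U x -> V x.
  have : nbhs x [set z | U (grdiv z x)].
    by apply: grdiv_continuousl; rewrite grdivv; exact: open_nbhs_nbhs.
  move=> xU /(_ _ xU)[u [Uu Uux]].
  by rewrite -(gaddKl (grdiv u x) x) grdivK; exact: UV.
have proper (F : set_system G) y : ProperFilter F -> F (closure U) ->
    coset_proj H @ F --> y ->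
    exists2 x, closure U x /\ coset_proj H x = y & cluster F x.
  have [a <-] : exists a, coset_proj H a = y.
    by case: y => C [a Ca]; exists a; exact: eq_exist.
  move=> FF FU Fa.
  apply: (cluster_coset H_strongL (closure U) K N V F a) => //.
  - exact: closed_closure.
  - exact: open_nbhs_nbhs.
  - move=> v c Vv /clUV Vc; apply: open_nbhs_nbhs; split=> //; exact: VN.
  - move=> b c Nb /clUV Vc Hbc; apply: WHK; split=> //; apply: NW => //.
    (* Writing [c] as [⊖ 0 ⊕ c] shows that [V] is contained in [N]. *)
    rewrite -(gaddKl 0 c) gadd0l; apply: VN => //.
    by case: V0.
exists U; split.
- by split.
- apply: closed_image_proper proper _ _ _ => //.
  + exact: closed_closure.
- apply: perfect_restrict_proper proper => //.
  + exact: coset_proj_continuous.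
  + exact: closed_closure.
- apply/seteqP; split=> // -[z p] _.
  have [x clx fx] := set_mem p.
  by exists (SigSub (mem_set clx)) => //; exact: val_inj.
Qed.
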